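(* For every positive integer $f$, $N(f)<N(f+2)$, where $N(f)$ denotes the number of numerical semigroups with Frobenius number $f$.
   Context: A numerical semigroup is a subset $S\subseteq\mathbb{N}=\{0,1,2,\dots\}$ that contains $0$, is closed under addition, and has finite complement in $\mathbb{N}$. The Frobenius number $f(S)$ is the largest element of $\mathbb{N}\setminus S$. *)

(* Defs.v *)
From mathcomp Require Import all_boot finmap.
From mathcomp Require Import boolp classical_sets functions cardinality.

Set Implicit Arguments.
Unset Strict Implicit.
Unset Printing Implicit Defensive.

Local Open Scope classical_set_scope.

Definition numerical_semigroup (S : set nat) : Prop :=
  [/\ S 0,
      forall a b : nat, S a -> S b -> S (a + b)
    & finite_set (~` S)].

(* A relation rather than a function: S = setT has no Frobenius number. *)
Definition is_frobenius (S : set nat) (f : nat) : Prop :=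
  ~ S f /\ forall n : nat, ~ S n -> n <= f.

Definition semigroups_with_frobenius (f : nat) : set (set nat) :=
  [set S | numerical_semigroup S /\ is_frobenius S f].

(* fset_set sends infinite sets to the empty set; this lemma shows that the
   default value is never used in the definition of N. *)
Lemma finite_semigroups_with_frobenius (f : nat) :
  finite_set (semigroups_with_frobenius f).
Proof.
pose g (A : {set 'I_f.+1}) : set nat :=
  [set n | f < n \/ exists2 i : 'I_f.+1, i \in A & val i = n].
apply: (@sub_finite_set _ _ (g @` setT)); last exact/finite_image/finite_finset.
move=> S [_ [_ maxf]] /=.
exists [set i : 'I_f.+1 | `[< S i >]]%SET => //.
apply/seteqP; split=> n /=.
  case=> [ltfn|[i]]; last by rewrite inE => /asboolP Si <-.
  by apply: contrapT => /maxf; rewrite leqNgt ltfn.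
move=> Sn; case: (ltnP f n) => [|lenf]; [by left | right].
by exists (Ordinal (lenf : n < f.+1)) => //; rewrite inE; apply/asboolP.
Qed.

Definition N (f : nat) : nat := #|` fset_set (semigroups_with_frobenius f)|.

(* Main.v *)
(* Put U(f) = 2 ^ floor((f - 1) / 2) and split the semigroups with Frobenius
   number f by their multiplicity m. Those with 2m > f consist of 0, an
   arbitrary set of integers in (f/2, f) and everything above f, so there are
   U(f) of them, and U(f + 2) = 2 U(f). Those with f/3 < m < f/2 inject into
   those with Frobenius number f + 2 and multiplicity m + 1, by moving the
   elements of [m, 2m) up by 1 and the larger ones up by 2. It remains to see
   that fewer than U(f) semigroups have 3m < f.

   Such a semigroup is determined by m and, for each residue r mod m other
   than 0 and f, the number k_r of elements of r + mN below f that it misses.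
   If the class of r has n elements in (0, f), then so does the class of s = f
   - r, and 1 <= k_r, k_s <= n since the least element of each class is
   missed, and k_r + k_s >= n since f is missed, which leaves n(n+3)/2 - 1
   choices (n/2 + 1 if r = s). On the other hand U(f) allows a factor 2 for
   each of the n pairs {x, f - x} these classes contain, and for n >= 3 the
   ratio is at most (7/8)^(n-3). Altogether there are at most U(f) (7/8)^j / 8
   semigroups of multiplicity m when 3(m + j) < f, and the sum over m of these
   bounds is less than U(f). *)
Require Import Defs.
From mathcomp Require Import boolp classical_sets functions cardinality.
From mathcomp Require Import all_boot finmap zify.

Set Implicit Arguments.
Unset Strict Implicit.
Unset Printing Implicit Defensive.

(** * Semigroups as subsets of {0, ..., f}, and multiplicity *)

Section Representation.
Variable f : nat.
Implicit Types (A B : {set 'I_f.+1}) (S : pred nat).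

(* A set of integers <= f stands for its union with (f, oo). *)
Definition elt A : pred nat := fun x => (f < x) || (inord x \in A).

Definition trunc S : {set 'I_f.+1} := [set i : 'I_f.+1 | S i].

Lemma elt_gt A x : f < x -> elt A x.
Proof. by rewrite /elt => ->. Qed.

Lemma elt_ord A (i : 'I_f.+1) : elt A i = (i \in A).
Proof. by rewrite /elt ltnNge -ltnS ltn_ord inord_val. Qed.

Lemma elt_trunc S x : elt (trunc S) x = (f < x) || S x.
Proof.
rewrite /elt; case: ltnP => //= xf.
by rewrite inE inordK.
Qed.

Lemma elt_inj A B : (forall x, x <= f -> elt A x = elt B x) -> A = B.
Proof.
by move=> AB; apply/setP => i; rewrite -!elt_ord AB // -ltnS.
Qed.

Definition semigroup_pred S : Prop :=
  [/\ S 0, forall a b, S a -> S b -> S (a + b), ~~ S f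
    & forall x, f < x -> S x].

Definition semigroups : {set {set 'I_f.+1}} :=
  [set A | `[< semigroup_pred (elt A) >]].

Lemma semigroupsP A : reflect (semigroup_pred (elt A)) (A \in semigroups).
Proof. by rewrite inE; exact: asboolP. Qed.

Definition eltset A : set nat := fun x => elt A x.

Lemma semigroups_eltset A :
  A \in semigroups -> semigroups_with_frobenius f (eltset A).
Proof.
move=> /semigroupsP[A0 AD Af Agt].
split; [split => //|split].
- apply: (@sub_finite_set _ _ `I_f.+1); last exact: finite_II.
  by move=> x /= /negP; rewrite ltnS leqNgt; apply: contra => /Agt.
- exact/negP.
- by move=> n; rewrite leqNgt => nA; apply/negP => /Agt.
Qed.

Lemma semigroups_surj (S : set nat) : semigroups_with_frobenius f S ->
  exists2 A, A \in semigroups & S = eltset A.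
Proof.
move=> [[S0 SD _] [Sf Sgt]].
have Sgt' n : f < n -> S n.
  by move=> fn; apply: contrapT => /Sgt; rewrite leqNgt fn.
pose A := trunc (fun x => `[< S x >]).
have AE x : elt A x = `[< S x >].
  rewrite elt_trunc; case: ltnP => //= fx.
  by symmetry; apply/asboolP; exact: Sgt'.
exists A; last first.
  by rewrite predeqE => x; rewrite /eltset AE; split=> /asboolP.
apply/semigroupsP; split; rewrite ?AE //.
- exact/asboolP.
- move=> a b; rewrite !AE => /asboolP Sa /asboolP Sb.
  by apply/asboolP; exact: SD.
- exact/asboolP.
- by move=> x fx; rewrite AE; apply/asboolP; exact: Sgt'.
Qed.

Lemma N_card : N f = #|semigroups|.
Proof.
rewrite /N.
suff -> : fset_set (semigroups_with_frobenius f) =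
          [fset eltset A | A in semigroups]%fset.
  rewrite card_in_imfset /=; first by rewrite cardE.
  move=> A B _ _ AB; apply: elt_inj => x _.
  by have := congr1 (fun S : set nat => S x) AB; rewrite /eltset => /is_true_inj.
apply/fsetP => S; rewrite in_fset_set; last exact: finite_semigroups_with_frobenius.
apply/idP/imfsetP => [|[A /= AG ->]].
  by rewrite in_setE => /semigroups_surj[A AG ->]; exists A.
by rewrite in_setE; exact: semigroups_eltset.
Qed.

Lemma ex_elt A : exists x, (0 < x) && elt A x.
Proof. by exists f.+1; rewrite elt_gt. Qed.

Definition mult A := ex_minn (ex_elt A).

Lemma mult_gt0 A : 0 < mult A.
Proof. by rewrite /mult; case: ex_minnP => x /andP[]. Qed.

Lemma elt_mult A : elt A (mult A).
Proof. by rewrite /mult; case: ex_minnP => x /andP[]. Qed.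

Lemma mult_le A x : 0 < x -> elt A x -> mult A <= x.
Proof.
by rewrite /mult => x0 Ax; case: ex_minnP => m _; apply; rewrite x0.
Qed.

Lemma elt_lt_mult A x : 0 < x -> x < mult A -> elt A x = false.
Proof.
by move=> x0 xm; apply/negP => /(mult_le x0); rewrite leqNgt xm.
Qed.

Lemma multE A m : 0 < m -> elt A m -> (forall x, 0 < x -> elt A x -> m <= x) ->
  mult A = m.
Proof.
move=> m0 Am mle; apply/eqP; rewrite eqn_leq mult_le //=.
by rewrite mle ?mult_gt0 ?elt_mult.
Qed.

End Representation.

Lemma elt_muln f (A : {set 'I_f.+1}) x k :
  A \in semigroups f -> elt A x -> elt A (k * x).
Proof.
move=> /semigroupsP[A0 AD _ _] Ax; elim: k => // k IH.
by rewrite mulSn AD.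
Qed.

Lemma mult_neq f (A : {set 'I_f.+1}) k : A \in semigroups f -> k * mult A != f.
Proof.
move=> AG; apply/eqP => kf.
have /semigroupsP[_ _ /negP Af _] := AG.
by apply: Af; rewrite -{2}kf; apply: elt_muln => //; exact: elt_mult.
Qed.

(** * Splitting by multiplicity *)

Definition large f := [set A in semigroups f | f < 2 * mult A].
Definition medium f :=
  [set A in semigroups f | (2 * mult A < f) && (f < 3 * mult A)].
Definition small f := [set A in semigroups f | 3 * mult A < f].

(** The cases [2 * mult A = f] and [3 * mult A = f], which no class covers, are excluded by
    [mult_neq]. *)
Lemma N_split f : N f = #|large f| + #|medium f| + #|small f|.
Proof.
have disj1 : [disjoint large f & medium f].
  by rewrite -setI_eq0; apply/eqP/setP => A; rewrite !inE; lia.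
have disj2 : [disjoint large f :|: medium f & small f].
  by rewrite -setI_eq0; apply/eqP/setP => A; rewrite !inE; lia.
have := leq_card_setU (large f) (medium f); rewrite disj1 => /leqifP/eqP <-.
have := leq_card_setU (large f :|: medium f) (small f).
rewrite disj2 => /leqifP/eqP <-.
rewrite N_card; congr #|pred_of_set _|; apply/setP => A; rewrite !in_setU !in_set.
case: (boolP (A \in semigroups f)) => [AG|]; last by rewrite inE => /negbTE ->.
have := mult_neq 2 AG; have := mult_neq 3 AG.
move: AG; rewrite inE => ->; lia.
Qed.

(** * Multiplicity above f/2 *)

Lemma card_ord_itv n a b : b <= n -> #|[set i : 'I_n | a <= i < b]| = b - a.
Proof.
move=> bn; have := sum_nat_const_nat a b 1; rewrite muln1 => <-.
rewrite big_geq_mkord (big_ord_widen_cond n (fun i => a <= i) (fun=> 1) bn).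
by rewrite -sum1_card; apply: eq_bigl => i; rewrite inE.
Qed.

Lemma card_large f : 0 < f -> #|large f| = 2 ^ (f.-1 %/ 2).
Proof.
move=> f0.
pose U := [set i : 'I_f.+1 | (f < 2 * i) && (i < f)].
have U0 : ord0 \notin U by rewrite inE.
have -> : large f = [set ord0 |: B | B in powerset U].
  apply/setP => A; apply/setIdP/imsetP => [[/semigroupsP[A0 AD Af _] fm]|].
    exists (A :\ ord0); last by rewrite setD1K // -elt_ord.
    rewrite powersetE; apply/subsetP => i; rewrite !inE -elt_ord => /andP[i0 Ai].
    have i1 : 0 < i by rewrite lt0n; apply: contra i0 => /eqP i0; exact/eqP/val_inj.
    have := mult_le i1 Ai; have := ltn_ord i.
    have : i != f :> nat by apply/eqP => iE; case/negP: Af; rewrite -[X in elt _ X]iE.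
    lia.
  move=> [B]; rewrite powersetE => /subsetP BU ->.
  have eltB x : elt (ord0 |: B) x -> (x == 0) || ((f < 2 * x) && (x != f)).
    rewrite /elt; case: (ltnP f x) => [fx _|xf /=]; first by apply/orP; right; lia.
    rewrite in_setU1 => /orP[/eqP/(congr1 val) /=|/BU].
      by rewrite inordK // => ->.
    by rewrite inE inordK //; lia.
  split.
    apply/semigroupsP; split.
    - by rewrite (elt_ord _ ord0) setU11.
    - move=> [|a] // [|b]; rewrite ?addn0 // => /eltB Ha /eltB Hb.
      by apply: elt_gt; move: Ha Hb; lia.
    - by apply/negP => /eltB; lia.
    - exact: elt_gt.
  by have := eltB _ (elt_mult (ord0 |: B)); have := mult_gt0 (ord0 |: B); lia.
rewrite card_in_imset; last first.
  move=> B C; rewrite !powersetE => BU CU /(congr1 (fun D => D :\ ord0)).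
  by rewrite !setU1K //; apply: contra U0; [move/(subsetP CU)|move/(subsetP BU)].
rewrite card_powerset; congr (2 ^ _).
have -> : U = [set i : 'I_f.+1 | (f %/ 2).+1 <= i < f].
  by apply/setP => i; rewrite !inE; lia.
by rewrite card_ord_itv //; lia.
Qed.

(** * Multiplicity between f/3 and f/2 *)

Lemma medium_le f : #|medium f| <= #|medium (f + 2)|.
Proof.
pose T (A : {set 'I_f.+1}) : {set 'I_(f + 2).+1} := trunc _ (fun x =>
  let m := mult A in
  [|| x == 0, (m < x <= 2 * m) && elt A (x - 1)
    | (2 * m + 2 <= x) && elt A (x - 2)]).
have eltT A x : elt (T A) x = (f + 2 < x) ||
  [|| x == 0, (mult A < x <= 2 * mult A) && elt A (x - 1)
    | (2 * mult A + 2 <= x) && elt A (x - 2)] by rewrite elt_trunc.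
have multT A : A \in medium f -> mult (T A) = (mult A).+1.
  move=> /setIdP[_ mf]; apply: multE => //.
    by rewrite eltT subn1 /= elt_mult; have := mult_gt0 A; lia.
  by move=> x x0; rewrite eltT; lia.
have imT : T @: medium f \subset medium (f + 2).
  apply/subsetP => _ /imsetP[A AM ->]; have Tm := multT _ AM.
  case/setIdP: AM => AG mf; apply/setIdP; rewrite Tm; split; last by lia.
  have /semigroupsP[A0 AD Af Agt] := AG.
  apply/semigroupsP; split.
  - by rewrite eltT eqxx orbT.
  - move=> a b; rewrite !eltT => Ha Hb.
    case: (ltnP (f + 2) (a + b)) => //= abf.
    case: (posnP a) => [a0|a0].
      by move: Hb; rewrite a0 add0n; case: (ltnP (f + 2) b) => //; lia.
    case: (posnP b) => [b0|b0].
      by move: Ha; rewrite b0 addn0; case: (ltnP (f + 2) a) => //; lia.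
    have am : mult A < a by lia.
    have bm : mult A < b by lia.
    (* As [f < 3 * mult A] and [a + b <= f + 2], both summands are at most [2 * mult A]: each was
       moved by 1, and their sum by 2. *)
    have Aa : elt A (a - 1) by move: Ha; lia.
    have Ab : elt A (b - 1) by move: Hb; lia.
    have := AD _ _ Aa Ab.
    have -> : a - 1 + (b - 1) = a + b - 2 by lia.
    by move=> ->; lia.
  - rewrite eltT addnK (negbTE Af); lia.
  - by move=> x xf; rewrite eltT xf.
rewrite -(card_in_imset (f := T)); first exact: subset_leq_card.
move=> A B AM BM TAB; have mAB : mult A = mult B.
  by apply: succn_inj; rewrite -!multT // TAB.
case/setIdP: AM => /semigroupsP[A0 _ Af _] mA.
case/setIdP: BM => /semigroupsP[B0 _ Bf _] _.
apply: elt_inj => x xf.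
case: (posnP x) => [->|x0]; first by rewrite A0 B0.
case: (ltnP x (mult A)) => [xm|mx]; first by rewrite !elt_lt_mult -?mAB.
case: (eqVneq x f) => [->|xf']; first by rewrite (negbTE Af) (negbTE Bf).
case: (ltnP x (2 * mult A)) => xm.
  have := congr1 (fun C => elt C (x + 1)) TAB; rewrite /= !eltT -mAB addnK; lia.
have := congr1 (fun C => elt C (x + 2)) TAB; rewrite /= !eltT -mAB addnK; lia.
Qed.

(** * Kunz coordinates *)

(* Equal to [n] when no element [r + j * m] with [j < n] lies in [S]. *)
Definition kunz (S : pred nat) m n r := find (fun j => S (r + j * m)) (iota 0 n).

Lemma kunz_leq (S : pred nat) m n r : kunz S m n r <= n.
Proof. by rewrite -{2}(size_iota 0 n) find_size. Qed.

Lemma kunz_elt (S : pred nat) m n r : kunz S m n r < n -> S (r + kunz S m n r * m).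
Proof.
move=> kn; have : has (fun j => S (r + j * m)) (iota 0 n).
  by rewrite has_find size_iota.
by move=> /(nth_find 0); rewrite nth_iota ?add0n.
Qed.

Lemma kunz_min (S : pred nat) m n r j : j < n -> S (r + j * m) -> kunz S m n r <= j.
Proof.
move=> jn Sj; rewrite leqNgt; apply/negP => jk.
by have := before_find 0 jk; rewrite nth_iota // add0n Sj.
Qed.

(** Adding [m] preserves membership, so a class is filled from its first element on. *)
Lemma kunzP f (A : {set 'I_f.+1}) m n r j : A \in semigroups f -> elt A m ->
  j < n -> elt A (r + j * m) = (kunz (elt A) m n r <= j).
Proof.
move=> AG Am jn; apply/idP/idP => [|kj]; first exact: kunz_min.
have /semigroupsP[_ AD _ _] := AG.
have := AD _ _ (kunz_elt (leq_ltn_trans kj jn))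
  (elt_muln (j - kunz (elt A) m n r) AG Am).
by rewrite -addnA -mulnDl subnKC.
Qed.

(** * Counting admissible pairs of coordinates *)

(** [diag] marks a residue that is its own partner. *)
Definition kunz_pairs n (diag : bool) : {set 'I_n.+1 * 'I_n.+1} :=
  [set p : 'I_n.+1 * 'I_n.+1 |
    [&& 0 < p.1, 0 < p.2, n <= p.1 + p.2 & diag ==> (p.1 == p.2)]].

Lemma card_kunz_pairs n : 0 < n -> 2 * #|kunz_pairs n false|.+1 <= n * (n + 3).
Proof.
case: n => // n _.
have sumE k : 2 * (\sum_(i < k) i.+2) = k * (k + 3).
  elim: k => [|k IH]; first by rewrite big_ord0.
  by rewrite big_ord_recr /= mulnDr IH; lia.
suff : #|kunz_pairs n.+1 false| <= (\sum_(i < n) i.+2) + n.+1.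
  by have := sumE n; nia.
pose Q (a b : 'I_n.+2) := [&& 0 < a, 0 < b & n < a + b].
have -> : #|kunz_pairs n.+1 false| = \sum_(a < n.+2) \sum_(b < n.+2 | Q a b) 1.
  rewrite (pair_big_dep xpredT Q (fun _ _ => 1)) -sum1_card.
  by apply: eq_bigl => p; rewrite inE /= andbT.
(* The minimum is [a.+1] except at [a = n.+1], where the choice [b = 0] is lost. *)
have cardQ (a : 'I_n.+2) : 0 < a -> \sum_(b < n.+2 | Q a b) 1 <= minn n.+1 a.+1.
  move=> a0; have aln := ltn_ord a.
  have -> : minn n.+1 a.+1 = n.+2 - maxn 1 (n.+1 - a) by lia.
  rewrite -(@card_ord_itv n.+2 _ n.+2) // -sum1_card leq_eqVlt; apply/orP; left.
  apply/eqP; apply: eq_bigl => b; rewrite inE /Q; have := ltn_ord b; lia.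
rewrite big_ord_recl big1 ?add0n //.
rewrite big_ord_recr /=; apply: leq_add.
  apply: leq_sum => i _; apply: leq_trans (cardQ _ _) _ => //=.
  by rewrite /bump /=; lia.
by apply: leq_trans (cardQ _ _) _ => //=; lia.
Qed.

Lemma card_kunz_pairs_diag n : 0 < n -> #|kunz_pairs n true| <= (n %/ 2).+1.
Proof.
move=> n0.
have -> : (n %/ 2).+1 = #|[set a : 'I_n.+1 | uphalf n <= a < n.+1]|.
  by rewrite card_ord_itv //; lia.
rewrite -(@card_in_imset _ _ fst).
  apply: subset_leq_card; apply/subsetP => _ /imsetP[[a b] /= + ->].
  rewrite !inE /= => /and4P[_ _ nab /eqP ab]; subst b.
  by have := ltn_ord a; lia.
move=> [a b] [c d]; rewrite !inE /= => /and4P[_ _ _ /eqP <-].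
by move=> /and4P[_ _ _ /eqP <-] ->.
Qed.

(* The number of pairs {x, f - x} contained in the classes of r and f - r. *)
Definition pair_weight n (diag : bool) := if diag then n %/ 2 else n.

(** At [n = 3] the available bounds 8 and 2 on the count equal the powers of 2. Off the diagonal,
    one step multiplies n(n+3)/2 - 1 by at most 13/8, below 2 * 7/8. *)
Lemma kunz_pairs_bound n diag : 3 <= n ->
  #|kunz_pairs n diag| * 8 ^ (n - 3) <= 2 ^ pair_weight n diag * 7 ^ (n - 3).
Proof.
move=> n3; have n0 : 0 < n by lia.
case: diag; rewrite /pair_weight.
  apply: leq_trans (leq_mul (card_kunz_pairs_diag n0) (leqnn _)) _.
  have -> : n = n - 3 + 3 by lia.
  rewrite addnK; move: (n - 3) => {n n3 n0} t.
  (* Because of the floor the induction advances by two: the count grows by at most 3/2, the bound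
     by 2 * (7/8)^2 = 49/32. *)
  suff : ((t + 3) %/ 2).+1 * 8 ^ t <= 2 ^ ((t + 3) %/ 2) * 7 ^ t /\
    ((t.+1 + 3) %/ 2).+1 * 8 ^ t.+1 <= 2 ^ ((t.+1 + 3) %/ 2) * 7 ^ t.+1 by case.
  elim: t => [|t [IH IH']]; first by [].
  split=> //; have -> : (t.+2 + 3) %/ 2 = ((t + 3) %/ 2).+1 by lia.
  have : 0 < (t + 3) %/ 2 by lia.
  rewrite !expnS; move: ((t + 3) %/ 2) IH => d.
  move: (8 ^ t) (7 ^ t) (2 ^ d) => x y z; nia.
have cP := card_kunz_pairs n0.
rewrite -(leq_pmul2l (isT : 0 < 2)).
have {cP} : 2 * #|kunz_pairs n false| <= n * (n + 3) - 2 by lia.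
move: #|_| => c cP; rewrite mulnA; apply: leq_trans (leq_mul cP (leqnn _)) _.
have -> : n = n - 3 + 3 by lia.
rewrite addnK; move: (n - 3) => {n n3 n0 c cP} t.
have -> : (t + 3) * (t + 3 + 3) - 2 = t * t + 9 * t + 16 by lia.
elim: t => [|t IH]; first by [].
rewrite addSn !expnS; move: IH.
move: (8 ^ t) (7 ^ t) (2 ^ (t + 3)) => x y z; nia.
Qed.

(** * Blocks of paired residues *)

(* The residues r in (0, l) are paired by r <-> l - r. With i = f mod m, the
   nonzero residues other than i split into two such blocks: (0, i), and (i, m)
   shifted by i, where l = m - i. *)
Definition block l n : {set {ffun 'I_(l %/ 2) -> 'I_n.+1 * 'I_n.+1}} :=
  [set g in family (fun r : 'I_(l %/ 2) => kunz_pairs n (2 * r.+1 == l))].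

(** The [l.-1] residues carry weight n/2 each, rounded down for a self-paired one. *)
Lemma block_bound l n : 0 < l -> 3 <= n ->
  #|block l n| * 8 ^ ((n - 3) * (l %/ 2)) <=
  2 ^ (n * l.-1 %/ 2) * 7 ^ ((n - 3) * (l %/ 2)).
Proof.
move=> l0 n3; rewrite cardsE card_family /image_mem foldrE big_map big_enum /=.
rewrite [8 ^ _]expnM [7 ^ _]expnM.
have powE x : x ^ (l %/ 2) = \prod_(r in 'I_(l %/ 2)) x.
  by rewrite prod_nat_const card_ord.
rewrite !powE -big_split /=.
apply: (@leq_trans (\prod_(r in 'I_(l %/ 2))
    (2 ^ pair_weight n (2 * r.+1 == l) * 7 ^ (n - 3)))).
  by apply: leq_prod => r _; exact: kunz_pairs_bound.
rewrite big_split /= leq_mul2r; apply/orP; right.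
rewrite -expn_sum leq_exp2l //.
case: (posnP (l %/ 2)) => [->|l2]; first by rewrite big_ord0.
have [k kE] : exists k, l %/ 2 = k.+1 by exists (l %/ 2).-1; lia.
(* Only the last index can be self-paired. *)
rewrite kE big_ord_recr /=.
rewrite (eq_bigr (fun=> n)) => [|r _]; last first.
  by rewrite /pair_weight ifF //; have := ltn_ord r; lia.
rewrite sum_nat_const card_ord /pair_weight; case: eqP => lE.
  by rewrite (_ : l.-1 = k * 2 + 1) ?mulnDr ?mulnA ?muln1 ?divnMDl //; lia.
rewrite (_ : l.-1 = k.+1 * 2); last by lia.
by rewrite mulnA mulnK // mulnSr [k * n]mulnC.
Qed.

(** * Semigroups of a fixed multiplicity *)

Definition semigroups_mult f m := [set A in semigroups f | mult A == m].

Definition encode (S : pred nat) m l n o :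
    {ffun 'I_(l %/ 2) -> 'I_n.+1 * 'I_n.+1} :=
  [ffun r : 'I_(l %/ 2) => (inord (kunz S m n (o + r.+1)),
                            inord (kunz S m n (o + (l - r.+1))))].

(** Paired residues sum to [2 * o + l], that is, to [f - n.-1 * m]; coordinates with sum below [n]
    would therefore put [f] in [A]. *)
Lemma encode_block f (A : {set 'I_f.+1}) m l n o : A \in semigroups f ->
  mult A = m -> 0 < n -> o + l <= m -> 2 * o + l + n.-1 * m = f ->
  encode (elt A) m l n o \in block l n.
Proof.
move=> AG Am n0 olm fE; rewrite inE; apply/familyP => r.
have rl := ltn_ord r; rewrite ffunE inE /= !inordK ?ltnS ?kunz_leq //.
have Am' : elt A m by rewrite -Am elt_mult.
have kgt0 s : 0 < s < m -> 0 < kunz (elt A) m n s.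
  move=> /andP[s0 sm]; rewrite ltnNge -(kunzP _ AG Am') // mul0n addn0.
  by rewrite elt_lt_mult // Am.
apply/and4P; split.
- by apply: kgt0; lia.
- by apply: kgt0; lia.
- set k := kunz _ _ _ _; set k' := kunz _ _ _ _.
  rewrite leqNgt; apply/negP => kk'.
  have kn : k < n by lia.
  have kn' : k' < n by lia.
  have /semigroupsP[_ AD /negP Af _] := AG; apply: Af.
  have := AD _ _ (AD _ _ (kunz_elt kn) (kunz_elt kn'))
    (elt_muln (n.-1 - (k + k')) AG Am').
  rewrite -/k -/k'; set x := (X in elt A X -> _).
  suff -> : x = f by [].
  rewrite /x -[RHS]fE; have -> : n.-1 = (k + k') + (n.-1 - (k + k')) by lia.
  rewrite addKn; lia.
- by apply/implyP => /eqP rE; apply/eqP; congr (inord (kunz _ _ _ (_ + _))); lia.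
Qed.

Lemma encode_inj (S S' : pred nat) m l n o : encode S m l n o = encode S' m l n o ->
  forall r, 0 < r < l -> kunz S m n (o + r) = kunz S' m n (o + r).
Proof.
move=> SS'.
have E (t : 'I_(l %/ 2)) : kunz S m n (o + t.+1) = kunz S' m n (o + t.+1) /\
    kunz S m n (o + (l - t.+1)) = kunz S' m n (o + (l - t.+1)).
  move/ffunP/(_ t): SS'; rewrite !ffunE => -[].
  move=> /(congr1 val) + /(congr1 val); rewrite /= !inordK ?ltnS ?kunz_leq //.
move=> r /andP[r0 rl]; case: (leqP r (l %/ 2)) => rl2.
  have rl' : r.-1 < l %/ 2 by lia.
  by have [+ _] := E (Ordinal rl'); rewrite /= prednK.
have rl' : (l - r).-1 < l %/ 2 by lia.
have [_] := E (Ordinal rl'); rewrite /= prednK ?subn_gt0 // subKn //; lia.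
Qed.

(** With f = Q m + i, a class below i has Q + 1 elements up to [f], one above i has Q. The classes
    of 0 and [f] are forced. *)
Lemma card_semigroups_mult f m : 0 < f %% m ->  0 < f %/ m ->
  #|semigroups_mult f m| <=
  #|block (f %% m) (f %/ m).+1| * #|block (m - f %% m) (f %/ m)|.
Proof.
move=> i0 Q0; have fE := divn_eq f m.
case: (posnP m) => [m0|m0]; first by move: Q0; rewrite m0 divn0.
have im := ltn_pmod f m0.
move: (f %/ m) (f %% m) Q0 i0 fE im => Q i Q0 i0 fE im.
rewrite -cardsX.
pose code (A : {set 'I_f.+1}) :=
  (encode (elt A) m i Q.+1 0, encode (elt A) m (m - i) Q i).
rewrite -(@card_in_imset _ _ code).
  apply: subset_leq_card; apply/subsetP => _ /imsetP[A /setIdP[AG /eqP Am] ->].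
  by rewrite inE /code /= !(encode_block AG Am) //; nia.
move=> A B /setIdP[AG /eqP Am] /setIdP[BG /eqP Bm].
move=> [/encode_inj E1 /encode_inj E2].
have /semigroupsP[A0 AD Af _] := AG.
have /semigroupsP[B0 BD Bf _] := BG.
apply: elt_inj => x xf; have xE := divn_eq x m; have rm := ltn_pmod x m0.
have Am' : elt A m by rewrite -Am elt_mult.
have Bm' : elt B m by rewrite -Bm elt_mult.
have kE n : x %/ m < n ->
    kunz (elt A) m n (x %% m) = kunz (elt B) m n (x %% m) -> elt A x = elt B x.
  move=> xn kAB.
  by rewrite xE addnC (kunzP _ AG Am' xn) (kunzP _ BG Bm' xn) kAB.
have xQ : x %/ m <= Q by rewrite -ltnS ltn_divLR // mulSn; lia.
case: (posnP (x %% m)) => [r0|r0].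
  by rewrite xE r0 addn0 !elt_muln.
case: (ltngtP (x %% m) i) => [ri|ri|ri].
- by apply: (kE Q.+1); [|rewrite -[x %% m]add0n E1 // r0].
- apply: (kE Q).
    rewrite ltn_neqAle xQ andbT; apply/eqP => xQ'.
    by move: xE; rewrite xQ'; lia.
  by rewrite -(subnKC (ltnW ri)) E2 //; lia.
(* From any member of its class up to [f], adding multiples of [m] would reach [f]. *)
have notin C : C \in semigroups f -> elt C m -> elt C x = false.
  move=> CG Cm; apply/negP => Cx; have /semigroupsP[_ CD /negP Cf _] := CG.
  apply: Cf; have := CD _ _ Cx (elt_muln (Q - x %/ m) CG Cm).
  set y := (X in elt C X -> _); suff -> : y = f by [].
  by rewrite /y {1}xE ri fE addnAC -mulnDl subnKC.
by rewrite !notin.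
Qed.

Lemma semigroups_mult_bound f m j : 0 < m -> 3 * (m + j) < f ->
  #|semigroups_mult f m| * 8 ^ j.+1 <= 7 ^ j * 2 ^ (f.-1 %/ 2).
Proof.
move=> m0 mjf; have fE := divn_eq f m; have im := ltn_pmod f m0.
case: (posnP (f %% m)) => [i0|i0].
  suff -> : semigroups_mult f m = set0 by rewrite cards0.
  apply/setP => A; rewrite inE [RHS]inE; apply/negP => /andP[AG /eqP Am].
  by have /eqP := mult_neq (f %/ m) AG; apply; rewrite Am {2}fE i0 addn0.
have Q3 : 3 <= f %/ m by rewrite leq_divRL //; lia.
have cX : #|semigroups_mult f m| <=
    #|block (f %% m) (f %/ m).+1| * #|block (m - f %% m) (f %/ m)|.
  by apply: card_semigroups_mult => //; lia.
have b1 : #|block (f %% m) (f %/ m).+1| * _ <= _ := block_bound i0 (leqW Q3).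
have mi : 0 < m - f %% m by lia.
have := block_bound mi Q3; clear mi.
move: #|semigroups_mult f m| (f %/ m) (f %% m) fE im i0 Q3 cX b1 => X Q i fE im i0 Q3.
set B1 := #|_|; set B2 := #|_| => cX b1 b2.
set a := (Q.+1 - 3) * (i %/ 2) in b1; set b := (Q - 3) * ((m - i) %/ 2) in b2.
set h1 := Q.+1 * i.-1 %/ 2 in b1; set h2 := Q * (m - i).-1 %/ 2 in b2.
(* The term [Q] counts the pairs {x, f - x} in the two forced classes. *)
have hU : Q + h1 + h2 <= f.-1 %/ 2.
  rewrite leq_divRL //.
  have := leq_trunc_div (Q.+1 * i.-1) 2; have := leq_trunc_div (Q * (m - i).-1) 2.
  rewrite -/h1 -/h2; nia.
(* Here [3 * j < (Q - 3) * m + i]; the term [Q - 3] offsets the rounding in [a] and [b]. *)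
have jE : j <= a + b + (Q - 3).
  have : (i %/ 2) * 2 + 1 >= i by lia.
  have : (m - i) %/ 2 * 2 + 1 >= m - i by lia.
  rewrite /a /b; move: (i %/ 2) ((m - i) %/ 2) => c d.
  have : Q.+1 - 3 = (Q - 3).+1 by lia.
  move=> -> Hd Hc; have : Q * m = (Q - 3) * m + 3 * m by nia.
  move=> QmE; have : 3 * j < (Q - 3) * m + i by lia.
  have : (Q - 3) * m <= (Q - 3) * (2 * c + 2 * d + 2) by rewrite leq_mul2l; lia.
  move: (Q - 3) => t; lia.
have main : X * 8 ^ (a + b) * 2 ^ Q <= 7 ^ (a + b) * 2 ^ (f.-1 %/ 2).
  apply: (@leq_trans ((B1 * 8 ^ a) * (B2 * 8 ^ b) * 2 ^ Q)).
    by rewrite leq_mul2r expnD mulnACA leq_mul2r cX !orbT.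
  apply: (@leq_trans ((2 ^ h1 * 7 ^ a) * (2 ^ h2 * 7 ^ b) * 2 ^ Q)).
    by rewrite leq_mul2r leq_mul ?orbT.
  have -> : 2 ^ h1 * 7 ^ a * (2 ^ h2 * 7 ^ b) * 2 ^ Q =
      7 ^ (a + b) * 2 ^ (Q + h1 + h2) by rewrite !expnD; lia.
  by rewrite leq_mul2l leq_exp2l // hU orbT.
set E := a + b + (Q - 3) in jE.
(* The gain [2 ^ Q] splits into 8, the extra factor on the left, and [2 ^ (Q - 3)], which is at
   least (8/7)^(Q-3). *)
have bound : X * 8 ^ E.+1 <= 7 ^ E * 2 ^ (f.-1 %/ 2).
  rewrite /E -addnS expnD [7 ^ _]expnD.
  have QE : 2 ^ Q = 8 * 2 ^ (Q - 3) by rewrite -[8]/(2 ^ 3) -expnD subnKC.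
  have le14 : 8 ^ (Q - 3) <= 2 ^ (Q - 3) * 7 ^ (Q - 3).
    by rewrite -expnMn; case: (Q - 3) => // t; rewrite leq_exp2r.
  have := leq_mul main (leqnn (7 ^ (Q - 3))); rewrite QE expnS.
  have := leq_mul (leqnn (X * 8 ^ (a + b) * 8)) le14.
  by move=> H H'; clear -H H'; lia.
have le78 : 7 ^ (E - j) <= 8 ^ (E - j) by case: (E - j) => // t; rewrite leq_exp2r.
rewrite -(@leq_pmul2r (8 ^ (E - j))) ?expn_gt0 //.
rewrite -mulnA -expnD addSn subnKC //; apply: leq_trans bound _.
by rewrite -{1}(subnKC jE) expnD mulnAC leq_mul2l le78 orbT.
Qed.

(** * Summing over the multiplicities *)

(** The terms (7/8)^j / 8 sum to 1 - (7/8)^k; keeping the remainder makes the final bound strict. *)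
Lemma geometric_sum_bound (c : nat -> nat) U k :
  (forall j, j < k -> c j * 8 ^ j.+1 <= 7 ^ j * U) ->
  (\sum_(j < k) c j) * 8 ^ k + 7 ^ k * U <= 8 ^ k * U.
Proof.
elim: k => [|k IH] cU; first by rewrite big_ord0 mul0n add0n.
have {}IH := IH (fun j jk => cU j (ltnW jk)).
have := cU k (ltnSn k); rewrite big_ord_recr /= !expnS.
by move: (\sum_(j < k) c j) (8 ^ k) (7 ^ k) IH => s x y; lia.
Qed.

Lemma card_small f : #|small f| < 2 ^ (f.-1 %/ 2).
Proof.
(* The largest m with 3m < f; for multiplicity [M - j] the saving exponent is [j]. *)
pose M := f.-1 %/ 3.
have sub : small f \subset \bigcup_(j < M) semigroups_mult f (M - j).
  apply/subsetP => A /setIdP[AG mf]; have m0 := mult_gt0 A.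
  have jM : M - mult A < M by rewrite /M; lia.
  apply/bigcupP; exists (Ordinal jM) => //.
  by apply/setIdP; split=> //=; rewrite /M; lia.
have le_sum : #|small f| <= \sum_(j < M) #|semigroups_mult f (M - j)|.
  apply: leq_trans (subset_leq_card sub) _.
  elim/big_ind2: _ => [|x X y Y xX yY|//]; first by rewrite cards0.
  by apply: leq_trans (leq_card_setU _ _) _; exact: leq_add.
apply: leq_ltn_trans le_sum _.
have bound := @geometric_sum_bound
  (fun j => #|semigroups_mult f (M - j)|) (2 ^ (f.-1 %/ 2)) M.
rewrite -(@ltn_pmul2r (8 ^ M)) ?expn_gt0 // [X in _ < X]mulnC.
apply: leq_trans (bound _).
  by rewrite -[X in X < _]addn0 ltn_add2l muln_gt0 !expn_gt0.
move=> j jM; apply: semigroups_mult_bound; rewrite ?subn_gt0 //.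
by rewrite subnK ?(ltnW jM) // /M; lia.
Qed.

Theorem theorem1p4 : forall f : nat, 0 < f -> N f < N (f + 2).
Proof.
move=> f f0; rewrite !N_split !card_large ?addn_gt0 ?f0 //.
have -> : (f + 2).-1 %/ 2 = (f.-1 %/ 2).+1 by lia.
(* The large class gains [2 ^ (f.-1 %/ 2)], which exceeds the whole small class of [f]. *)
have := card_small f; have := medium_le f; rewrite expnS; lia.
Qed.
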